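(* Let $[X,\mathcal B,m,\nu]$ be a random walk space with $\nu$ reversible with respect to $m$, and let $p>1$. Then the operator $-\Delta_p^m$ is completely accretive, and for all $u,v\in L^2(X,\nu)$, $$(u,v)\in\Delta_p^m\iff (u,-v)\in\partial_{L^2(X,\nu)}\mathcal F_{p,m}(u).$$
   Context: A random walk space $[X,\mathcal B,m,\nu]$ consists of a measurable space $(X,\mathcal B)$ with $\mathcal B$ countably generated, a family $m=(m_x)_{x\in X}$ of probability measures on $\mathcal B$ such that $x\mapsto m_x(B)$ is measurable for each $B\in\mathcal B$, and a $\sigma$-finite measure $\nu$ that is invariant: $\nu(A)=\int_X m_x(A)\,d\nu(x)$ for all $A\in\mathcal B$. Reversibility means $dm_x(y)\,d\nu(x)=dm_y(x)\,d\nu(y)$ as measures on $X\times X$. $\nu\otimes m_x$ is the measure on $X\times X$ with $(\nu\otimes m_x)(A\times B)=\int_A m_x(B)\,d\nu(x)$. For $u:X\to\mathbb R$, $\nabla u(x,y)=u(y)-u(x)$. For $p\ge1$, $\mathcal F_{p,m}:L^2(X,\nu)\to[0,+\infty]$ is $\mathcal F_{p,m}(u)=\frac1{2p}\int_{X\times X}|\nabla u|^p\,d(\nu\otimes m_x)$ if this is finite, and $+\infty$ otherwise. The operator $\Delta_p^m$ ($p>1$) is the set of pairs $(u,v)$ with $u,v\in L^2(X,\nu)$, $\nabla u\in L^p(X\times X,\nu\otimes m_x)$ and $v(x)=\int_X|\nabla u(x,y)|^{p-2}\nabla u(x,y)\,dm_x(y)$ for $\nu$-a.e. $x$. For a proper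 convex functional $\mathcal F$ on a Hilbert space $H$, $\partial_H\mathcal F(u)=\{v\in H:\mathcal F(w)-\mathcal F(u)\ge (v,w-u)\ \forall w\in H\}$. An operator $A\subset L^2\times L^2$ (a multivalued map identified with its graph) is completely accretive if for all $\lambda>0$ and $(u_1,v_1),(u_2,v_2)\in A$ one has $\int_X j(u_1-u_2)\,d\nu\le\int_X j(u_1-u_2+\lambda(v_1-v_2))\,d\nu$ for every convex lower semicontinuous $j:\mathbb R\to[0,+\infty]$ with $j(0)=0$. *)

(* Defs.v *)
From HB Require Import structures.
From mathcomp Require Import all_boot all_order all_algebra.
From mathcomp Require Import all_classical all_reals all_analysis.
Set Implicit Arguments. Unset Strict Implicit. Unset Printing Implicit Defensive.
Import Order.TTheory GRing.Theory Num.Theory.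
Import numFieldNormedType.Exports.
Local Open Scope classical_set_scope.
Local Open Scope ring_scope.

Definition countably_generated (d : measure_display) (T : measurableType d) : Prop :=
  exists G : (set T)^nat, (@measurable d T) = <<s range G >>.

Definition rw_invariant (d : measure_display) (T : measurableType d) (R : realType)
  (nu : {measure set T -> \bar R}) (m : R.-pker T ~> T) : Prop :=
  forall A : set T, measurable A -> nu A = (\int[nu]_x m x A)%E.

(* Reversibility: dm_x(y) dnu(x) = dm_y(x) dnu(y) as measures on X x X,
   i.e. both measures agree on measurable rectangles A x B. *)
Definition rw_reversible (d : measure_display) (T : measurableType d) (R : realType)
  (nu : {measure set T -> \bar R}) (m : R.-pker T ~> T) : Prop :=
  forall A B : set T, measurable A -> measurable B ->
    (\int[nu]_(x in A) m x B = \int[nu]_(y in B) m y A)%E.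

(* u is (a representative of an element of) L^2(X, nu). *)
Definition L2 (d : measure_display) (T : measurableType d) (R : realType)
  (nu : {measure set T -> \bar R}) (u : T -> R) : Prop :=
  measurable_fun setT u /\ (\int[nu]_x ((`|u x| ^+ 2)%:E) < +oo)%E.

Definition grad (T : Type) (R : realType) (u : T -> R) (x y : T) : R := u y - u x.

(* int_{X x X} |nabla u|^p d(nu (x) m_x)  (nonnegative integrand, written as
   the iterated integral defining nu (x) m_x). *)
Definition energy (d : measure_display) (T : measurableType d) (R : realType)
  (nu : {measure set T -> \bar R}) (m : R.-pker T ~> T) (p : R) (u : T -> R) : \bar R :=
  (\int[nu]_x \int[m x]_y ((`|grad u x y| `^ p)%:E))%E.

Definition Fpm (d : measure_display) (T : measurableType d) (R : realType)
  (nu : {measure set T -> \bar R}) (m : R.-pker T ~> T) (p : R) (u : T -> R) : \bar R :=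
  if pselect (L2 nu u /\ (energy nu m p u < +oo)%E)
  then (((2 * p)^-1)%:E * energy nu m p u)%E else +oo%E.

(* |t|^{p-2} t, with the value 0 at t = 0 *)
Definition spow (R : realType) (p t : R) : R := Num.sg t * (`|t| `^ (p - 1)).

Definition Delta_p (d : measure_display) (T : measurableType d) (R : realType)
  (nu : {measure set T -> \bar R}) (m : R.-pker T ~> T) (p : R)
  (u v : T -> R) : Prop :=
  [/\ L2 nu u, L2 nu v, (energy nu m p u < +oo)%E &
      {ae nu, forall x, (\int[m x]_y (spow p (grad u x y))%:E = (v x)%:E)%E}].

Definition subdiff_L2 (d : measure_display) (T : measurableType d) (R : realType)
  (nu : {measure set T -> \bar R}) (F : (T -> R) -> \bar R) (u v : T -> R) : Prop :=
  [/\ L2 nu u, L2 nu v, (F u < +oo)%E &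
      forall w, L2 nu w ->
        (\int[nu]_x ((v x * (w x - u x))%R%:E) <= F w - F u)%E].

Definition convex_ereal (R : realType) (j : R -> \bar R) : Prop :=
  forall (x y t : R), (0 <= t)%R -> (t <= 1)%R ->
    (j (t * x + (1 - t) * y)%R <= t%:E * j x + (1 - t)%R%:E * j y)%E.

Definition completely_accretive (d : measure_display) (T : measurableType d)
  (R : realType) (nu : {measure set T -> \bar R})
  (A : (T -> R) -> (T -> R) -> Prop) : Prop :=
  forall (lam : R), 0 < lam ->
  forall u1 v1 u2 v2, A u1 v1 -> A u2 v2 ->
  forall j : R -> \bar R, convex_ereal j -> lower_semicontinuous j ->
    (forall r, (0 <= j r)%E) -> j 0 = 0%E ->
    (\int[nu]_x j (u1 x - u2 x)%R
       <= \int[nu]_x j (u1 x - u2 x + lam * (v1 x - v2 x))%R)%E.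

Definition neg_op (T : Type) (R : realType) (A : (T -> R) -> (T -> R) -> Prop)
  (u v : T -> R) : Prop := A u (fun x => - v x).

(* Main.v *)
(**
Let [P] be the measure [nu (x) m_x] on [T * T]; reversibility says that [P] is
invariant under exchanging the two variables. For a test function [phi]
(bounded, supported in a set of finite measure) everything is [P]-integrable,
and this symmetry gives the weak formulation
  [\int phi v dnu = - 1/2 \int |grad u|^(p-2) grad u grad phi dP]
for [v] the [p]-Laplacian of [u]. It extends to all [phi] in [L2] of finite
energy by the truncations [T_n - T_(1/n)], which are contractions.

Subdifferential: convexity of [|t|^p / p] and the weak formulation with
[phi = w - u] give one inclusion. Conversely, testing the subdifferential
inequality with [w = u + t phi], dividing by [t] and letting [t] tend to [0]
gives the weak formulation for [phi = +- 1_A], which determines [v] almost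
everywhere.

Complete accretivity: [j] is the increasing limit of maxima [g_n] of finitely
many affine minorants that are negative at [0]. These have a bounded
nondecreasing subgradient [q_n] that vanishes near [0], so
[q_n (u1 - u2)] is a test function, and the weak formulation together with the
monotonicity of [|t|^(p-2) t] yields [\int q_n (u1 - u2) (v1 - v2) dnu >= 0].
Monotone convergence concludes.
*)
Require Import Defs.
From HB Require Import structures.
From mathcomp Require Import all_boot all_order all_algebra.
From mathcomp Require Import all_classical all_reals all_analysis.
From mathcomp Require Import measurable_realfun ring lra.
Import Order.TTheory GRing.Theory Num.Theory.
Import numFieldNormedType.Exports.
Local Open Scope classical_set_scope.
Local Open Scope ring_scope.

Set Implicit Arguments.
Unset Strict Implicit.
Unset Printing Implicit Defensive.

(** * The signed power [|t|^(p-2) t]: Young inequality, monotonicity, continuity *)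

Section spow.
Context {R : realType}.
Implicit Types p a b t : R.

Lemma spowN p t : spow p (- t) = - spow p t.
Proof. by rewrite /spow sgrN normrN mulNr. Qed.

Lemma normr_spow p t : 1 < p -> `|spow p t| = `|t| `^ (p - 1).
Proof.
move=> p1; rewrite /spow normrM normr_sg (ger0_norm (powR_ge0 _ _)).
have [->|t0] := eqVneq t 0; last by rewrite mul1r.
by rewrite mul0r normr0 powR0// subr_eq0 gt_eqF.
Qed.

Lemma spow_mulr p t : 1 < p -> spow p t * t = `|t| `^ p.
Proof.
move=> p1; rewrite /spow mulrAC -normrEsg mulr_powRB1//.
by rewrite (lt_trans ltr01).
Qed.

(** Young's inequality for [|a|^(p-1)] and [|b|] with the conjugate exponents [p/(p-1)] and [p]. *)
Lemma spow_young p a b : 1 < p ->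
  `|spow p a * b| <= (1 - p^-1) * `|a| `^ p + p^-1 * `|b| `^ p.
Proof.
move=> p1; have p0 : 0 < p by rewrite (lt_trans ltr01).
have p10 : 0 < p - 1 by rewrite subr_gt0.
rewrite normrM normr_spow//.
have q0 : 0 < p / (p - 1) by rewrite divr_gt0.
have pq : (p / (p - 1))^-1 + p^-1 = 1.
  by field; rewrite !gt_eqF.
have := conjugate_powR (powR_ge0 `|a| (p - 1)) (normr_ge0 b) q0 p0 pq.
rewrite -powRrM [(p - 1) * _]mulrC divfK ?gt_eqF// => /le_trans; apply.
have -> : 1 - p^-1 = (p / (p - 1))^-1 by rewrite -[in LHS]pq addrK.
by rewrite mulrC lerD2l mulrC.
Qed.

Lemma spow_young_le p a b : 1 < p ->
  `|spow p a * b| <= `|a| `^ p + `|b| `^ p.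
Proof.
move=> p1; have p0 : 0 < p by rewrite (lt_trans ltr01).
apply: (le_trans (spow_young _ _ p1)); apply: lerD.
  by rewrite ler_piMl ?powR_ge0// gerBl invr_ge0 ltW.
by rewrite ler_piMl ?powR_ge0// invf_le1// ltW.
Qed.

(** This is the tangent inequality of the convex function [|t|^p / p]. Since [spow p a * a = |a|^p],
    it is [spow_young] with the term [(1 - 1/p) |a|^p] moved across. *)
Lemma spow_subgradient p a b : 1 < p ->
  spow p a * (b - a) <= p^-1 * (`|b| `^ p - `|a| `^ p).
Proof.
move=> p1; rewrite mulrBr spow_mulr//.
have := le_trans (ler_norm _) (spow_young a b p1); lra.
Qed.

Lemma spow_monotone p a b : 1 < p -> 0 <= (spow p a - spow p b) * (a - b).
Proof.
move=> p1; have := spow_subgradient a b p1; have := spow_subgradient b a p1.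
lra.
Qed.

Lemma spow_nondecreasing p : 1 < p -> {homo spow p : a b / a <= b}.
Proof.
move=> p1 a b; rewrite le_eqVlt => /predU1P[->//|ab].
rewrite -subr_ge0 -(@pmulr_lge0 _ (b - a)) ?subr_gt0//.
exact: spow_monotone.
Qed.

(** [spow p] raises the absolute value to the power [p - 1], so its inverse is the signed power of
    conjugate exponent [1 + 1/(p-1)]. *)
Lemma spowK p : 1 < p -> cancel (spow p) (spow (1 + (p - 1)^-1)).
Proof.
move=> p1 t; have p10 : 0 < p - 1 by rewrite subr_gt0.
rewrite {1}/spow normr_spow// addrAC subrr add0r -powRrM divff ?gt_eqF//.
rewrite powRr1// /spow sgrM sgr_id.
have [->|t0] := eqVneq t 0; first by rewrite normr0 mulr0.
by rewrite [Num.sg (_ `^ _)]gtr0_sg ?powR_gt0 ?normr_gt0// mulr1 mulr_sg_norm.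
Qed.

(** The inverse [spow q] is strictly increasing, so it pulls the interval of radius [e] around
    [spow p a] back to an interval with [a] in its interior; monotonicity of [spow p] carries that
    interval into the first one. *)
Lemma spow_continuous p : 1 < p -> continuous (spow p).
Proof.
move=> p1 a; set q := 1 + (p - 1)^-1.
have p10 : 0 < p - 1 by rewrite subr_gt0.
have q1 : 1 < q by rewrite ltrDl invr_gt0.
have pE : p = 1 + (q - 1)^-1 by rewrite /q addrAC subrr add0r invrK subrKC.
have qK : cancel (spow q) (spow p) by rewrite pE; exact: spowK.
have pK := spowK p1.
have lt_spowq x y : x < y -> spow q x < spow q y.
  move=> xy; rewrite lt_neqAle spow_nondecreasing ?ltW// andbT.
  by rewrite (inj_eq (can_inj qK)) lt_eqF.
apply/cvgrPdist_le => e e0.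
have aE : spow q (spow p a) = a by exact: pK.
have la : spow q (spow p a - e) < a by rewrite -[ltRHS]aE lt_spowq// gtrBl.
have ar : a < spow q (spow p a + e) by rewrite -[ltLHS]aE lt_spowq// ltrDl.
near=> x.
have lx : spow q (spow p a - e) <= x.
  by apply/ltW; near: x; exact: lt_nbhsr.
have xr : x <= spow q (spow p a + e).
  by apply/ltW; near: x; exact: lt_nbhsl.
move/(spow_nondecreasing p1) : lx; rewrite qK => lx.
move/(spow_nondecreasing p1) : xr; rewrite qK => xr.
rewrite ler_norml; apply/andP; split; lra.
Unshelve. all: by end_near. Qed.

Lemma measurable_spow p : 1 < p -> measurable_fun [set: R] (spow p).
Proof.
move=> p1; apply: nondecreasing_measurable => // a b.
exact: spow_nondecreasing.
Qed.

Lemma powR_normD_le p a b : 0 <= p ->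
  `|a + b| `^ p <= 2 `^ p * (`|a| `^ p + `|b| `^ p).
Proof.
move=> p0.
have [ab|ba] := leP `|a| `|b|.
  apply: (@le_trans _ _ (2 `^ p * `|b| `^ p)); last first.
    by rewrite ler_wpM2l ?powR_ge0// lerDr powR_ge0.
  rewrite -powRM//; apply: ge0_ler_powR; rewrite ?nnegrE ?mulr_ge0//.
  by apply: (le_trans (ler_normD _ _)); lra.
apply: (@le_trans _ _ (2 `^ p * `|a| `^ p)); last first.
  by rewrite ler_wpM2l ?powR_ge0// lerDl powR_ge0.
rewrite -powRM//; apply: ge0_ler_powR; rewrite ?nnegrE ?mulr_ge0//.
by apply: (le_trans (ler_normD _ _)); lra.
Qed.

(** Controls [|grad u|^(p-1)] by the energy density wherever constants are integrable. *)
Lemma powR_le_1D p a : 1 < p -> 0 <= a -> a `^ (p - 1) <= 1 + a `^ p.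
Proof.
move=> p1 a0; have [a1|a1] := leP a 1.
  rewrite -[leLHS]addr0 lerD ?powR_ge0//.
  have := @ge0_ler_powR _ (p - 1); rewrite subr_ge0 => /(_ (ltW p1) a 1).
  by rewrite !nnegrE powR1; exact.
rewrite -[leLHS]add0r lerD//; apply: ler_powR; first exact: ltW.
by rewrite lerBlDr lerDl.
Qed.

End spow.

(** By monotonicity, [spow p (a + t * b) * b] lies between its values at [t = 0] and [t = 1]. The
    bound does not depend on [t], which gives a majorant for the limit [t -> 0]. *)
Lemma spow_segment_le {R : realType} (p a b t : R) : 1 < p -> 0 <= t <= 1 ->
  `|spow p (a + t * b) * b| <= `|spow p a * b| + `|spow p (a + b) * b|.
Proof.
move=> p1 /andP[t0 t1]; set x := spow p a; set z := spow p (a + b).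
set y := spow p (a + t * b).
have [xy yz] : x * b <= y * b /\ y * b <= z * b.
  have [b0|b0] := leP 0 b.
    by split; apply: ler_wpM2r => //; apply: spow_nondecreasing => //; nra.
  by split; apply: ler_wnM2r; rewrite ?(ltW b0)//; apply: spow_nondecreasing => //; nra.
have := ler_norm (z * b); have := ler_norm (- (x * b)); rewrite normrN.
have := normr_ge0 (x * b); have := normr_ge0 (z * b).
by rewrite ler_norml => *; apply/andP; split; lra.
Qed.

(** * Truncations that are bounded, vanish near zero and are contractions *)

Section trunc.
Context {R : realType}.
Implicit Types e x y : R.

Definition clamp e x : R := Num.max (- e) (Num.min e x).

(** The first clamp makes the values bounded. Subtracting the second one makes them vanish near [0],
    so that the truncation of an [L2] function lives on a set of finite measure. *)
Definition trunc (n : nat) x : R := clamp n.+1%:R x - clamp n.+1%:R^-1 x.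

Let trunc_bounds n : 0 < (n.+1%:R^-1 : R) /\ (n.+1%:R^-1 : R) <= n.+1%:R.
Proof.
split; first by rewrite invr_gt0 ltr0n.
apply: (@le_trans _ _ 1); last by rewrite ler1n.
by rewrite invf_le1 ?ler1n ?ltr0n.
Qed.

Lemma trunc_eq0 n x : `|x| <= n.+1%:R^-1 -> trunc n x = 0.
Proof.
have [] := trunc_bounds n; rewrite /trunc /clamp.
move: (_^-1) => e; move: (_.+1%:R : R) => K e0 eK /ler_normlP[? ?].
by do ![rewrite minEle | rewrite maxEle]; do ![case: ifP]; lra.
Qed.

Lemma normr_trunc_le_cst n x : `|trunc n x| <= n.+1%:R.
Proof.
have [] := trunc_bounds n; rewrite /trunc /clamp.
move: (_^-1) => e; move: (_.+1%:R : R) => K e0 eK; apply/ler_normlP.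
by split; do ![rewrite minEle | rewrite maxEle]; do ![case: ifP]; lra.
Qed.

Lemma clampB e x y : 0 <= e -> y <= x ->
  0 <= clamp e x - clamp e y <= x - y.
Proof.
move=> e0 xy; rewrite /clamp !minEle !maxEle.
by apply/andP; do ![case: ifP]; split; lra.
Qed.

(** For [y <= x] the increments of both clamps lie in [[0, x - y]], hence their difference lies in
    [[-(x - y), x - y]]. *)
Lemma trunc_contraction n x y : `|trunc n x - trunc n y| <= `|x - y|.
Proof.
wlog xy : x y / y <= x.
  move=> H; have [|/ltW yx] := leP y x; first exact: H.
  by rewrite distrC [leRHS]distrC; exact: H.
rewrite [leRHS]ger0_norm ?subr_ge0//.
have [k0 kK] := trunc_bounds n; have K0 := le_trans (ltW k0) kK.
have /andP[A1 A2] := clampB K0 xy.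
have /andP[B1 B2] := clampB (ltW k0) xy.
by rewrite /trunc; apply/ler_normlP; split; lra.
Qed.

Lemma normr_trunc_le n x : `|trunc n x| <= `|x|.
Proof.
have := trunc_contraction n x 0; rewrite [trunc n 0]trunc_eq0 ?subr0//.
by rewrite normr0 invr_ge0.
Qed.

Lemma cvg_trunc x : trunc n x @[n --> \oo] --> x.
Proof.
apply/cvgrPdist_le => e e0; near=> n.
have [k0 kK] := trunc_bounds n.
(* For such [n] the large clamp fixes [x], and the error is the small clamp of [x], at most
   [1/(n+1)]. *)
have : `|x| <= n.+1%:R.
  near: n; exists (Num.trunc `|x|).+1 => // n /= xn.
  apply: (@le_trans _ _ (Num.trunc `|x|).+1%:R); last by rewrite ler_nat ltnW.
  by rewrite ltW// truncnS_gt.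
have : (n.+1%:R^-1 : R) <= e.
  by apply/ltW; near: n; exact: near_infty_natSinv_lt (PosNum e0).
move: k0 kK; rewrite /trunc /clamp.
move: (_^-1) => k; move: (_.+1%:R : R) => K k0 kK ke /ler_normlP[xK Kx].
apply/ler_normlP.
by split; do ![rewrite minEle | rewrite maxEle]; do ![case: ifP]; lra.
Unshelve. all: by end_near. Qed.

Lemma measurable_trunc n : measurable_fun [set: R] (trunc n).
Proof.
by apply: measurable_funB; apply: measurable_maxr => //; exact: measurable_minr.
Qed.

End trunc.

(** * Countably many affine minorants of a convex lower semicontinuous function *)

Section convex_minorants.
Context {R : realType}.
Implicit Types (j : R -> \bar R) (r M : R).

(* The line through [(r, M')] with [M < M' < j r] whose slope is the supremum
   of the slopes from the left lies below [j]; lower semicontinuity at [r]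
   makes this supremum finite. *)
Lemma convex_lsc_minorant_gt0 j r M :
  convex_ereal j -> lower_semicontinuous j -> (forall x, (0 <= j x)%E) ->
  j 0 = 0%E -> 0 < r -> 0 <= M -> (M%:E < j r)%E ->
  exists a b : R, [/\ 0 < a, 0 <= b, forall x, ((a * x - b)%:E <= j x)%E &
                      M < a * r - b].
Proof.
move=> cj lj j0 j00 r0 M0 Mj.
have [M' MM' M'j] : exists2 M', M < M' & (M'%:E < j r)%E.
  case: (j r) Mj => [x| |] // Mx; last by exists (M + 1); rewrite ?ltrDl ?ltry.
  by rewrite lte_fin in Mx; exists ((M + x) / 2); rewrite ?lte_fin; lra.
have [V /nbhs_ballP[e /= e0 eV] Vj] := lj _ _ M'j.
have M'0 : 0 < M' by exact: le_lt_trans MM'.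
have jfin x : (j x < +oo)%E -> j x = (fine (j x))%:E /\ 0 <= fine (j x).
  move=> xy; split; last exact: fine_ge0.
  by rewrite fineK// ge0_fin_numE.
(* The slopes of the segments from [(x, j x)], with [x < r], to [(r, M')]; the point [x = 0]
   contributes [M' / r > 0]. *)
pose S := [set (M' - fine (j x)) / (r - x) | x in
             [set x | x < r /\ (j x < +oo)%E]].
have S0 : S (M' / r) by exists 0; rewrite /= j00 ?subr0.
(* Within distance [e] of [r] one has [j x > M'], and the slope is not positive; farther away,
   [j x >= 0] bounds it by [M' / e]. *)
have ubS : ubound S (M' / e).
  move=> _ [x [xr /jfin[jxE jx0]] <-].
  have rx : 0 < r - x by rewrite subr_gt0.
  have [rxe|erx] := ltP (r - x) e.
    have : (M'%:E < j x)%E by apply/Vj/eV; rewrite /ball/= gtr0_norm.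
    rewrite jxE lte_fin => M'x; apply: (@le_trans _ _ 0).
      by rewrite pmulr_lle0 ?invr_gt0// subr_le0 ltW.
    by rewrite divr_ge0 ?ltW.
  rewrite ler_pdivrMr// mulrAC ler_pdivlMr//.
  apply: (@le_trans _ _ (M' * e)); last by rewrite ler_pM2l.
  by rewrite ler_pM2r// gerBl.
have supS : has_sup S by split; [exists (M' / r) | exists (M' / e)].
pose a := sup S.
have aM' : M' / r <= a by apply: ub_le_sup => //; exact: supS.2.
have a0 : 0 < a by apply: lt_le_trans aM'; rewrite divr_gt0.
exists a, (a * r - M'); split => //.
- by rewrite subr_ge0 -ler_pdivrMr.
- move=> x; have [jxy|] := ltP (j x) +oo%E; last first.
    by rewrite leye_eq => /eqP ->; rewrite leey.
  have [jxE jx0] := jfin _ jxy; have [xr|rx|->] := ltgtP x r.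
  + have rx : 0 < r - x by rewrite subr_gt0.
    have : (M' - fine (j x)) / (r - x) <= a.
      by apply: ub_le_sup; [exact: supS.2|exists x].
    by rewrite ler_pdivrMr// jxE lee_fin => ?; lra.
  + have xr : 0 < x - r by rewrite subr_gt0.
    (* Every left slope is at most this right slope: for [y < r < x], the chord of [j] from [y] to
       [x] is at least [j r > M'] at [r]. *)
    have : a <= (fine (j x) - M') / (x - r).
      apply: ge_sup; first by exists (M' / r).
      move=> _ [y [yr /jfin[jyE jy0]] <-].
      have ry : 0 < r - y by rewrite subr_gt0.
      have xy : 0 < x - y by lra.
      rewrite ler_pdivrMr// mulrAC ler_pdivlMr//.
      have := cj y x ((x - r) / (x - y)).
      have -> : (x - r) / (x - y) * y + (1 - (x - r) / (x - y)) * x = r.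
        by field; rewrite gt_eqF.
      have -> : 1 - (x - r) / (x - y) = (r - y) / (x - y).
        by field; rewrite gt_eqF.
      rewrite divr_ge0 ?(ltW xy) ?(ltW xr)// ler_pdivrMr// mul1r.
      move=> /(_ isT); rewrite lerD2l lerN2 ltW// => /(_ isT)/(lt_le_trans M'j).
      rewrite jyE jxE /= lte_fin -(ltr_pM2r xy).
      rewrite mulrDl [_ / _ * _ * _]mulrAC divfK ?gt_eqF//.
      by rewrite [_ / _ * _ * _]mulrAC divfK ?gt_eqF//; lra.
    by rewrite ler_pdivlMr// jxE lee_fin => ?; lra.
  + by rewrite subKr ltW.
- by rewrite subKr.
Qed.

(** Rational coefficients make the family countable. Lowering the slope, still positive, and raising
    [b] keeps the line below [j] for [x >= 0]; for [x < 0] the new line is negative. The gap [g] at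
    [r] is shared equally between the two changes. *)
Lemma convex_lsc_rat_minorant_gt0 j r M :
  convex_ereal j -> lower_semicontinuous j -> (forall x, (0 <= j x)%E) ->
  j 0 = 0%E -> 0 < r -> 0 <= M -> (M%:E < j r)%E ->
  exists a b : rat, [/\ 0 < ratr b :> R,
    forall x, ((ratr a * x - ratr b)%:E <= j x)%E & M < ratr a * r - ratr b].
Proof.
move=> cj lj j0 j00 r0 M0 Mj.
have [a [b [a0 b0 abj Mab]]] := convex_lsc_minorant_gt0 cj lj j0 j00 r0 M0 Mj.
pose g := a * r - b - M; have g0 : 0 < g by rewrite /g; lra.
have [|b' ] := @rat_in_itvoo R b (b + g / 2); first lra.
rewrite in_itv/= => /andP[bb' b'g].
have [|a' ] := @rat_in_itvoo R (Num.max 0 (a - g / 2 / r)) a.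
  by rewrite gt_max a0/= gtrBl !divr_gt0.
rewrite in_itv/= gt_max => /andP[/andP[a'0 aa'] a'a].
exists a', b'; split; first exact: le_lt_trans bb'.
  move=> x; have [x0|x0] := leP 0 x.
    apply: (le_trans _ (abj x)); rewrite lee_fin.
    by apply: lerB; [rewrite ler_wpM2r// ltW|exact: ltW].
  apply: (le_trans _ (j0 x)); rewrite lee_fin subr_le0.
  apply: (@le_trans _ _ 0); last by rewrite (le_trans b0)// ltW.
  by rewrite nmulr_lle0 // ltW.
have : (a - g / 2 / r) * r < ratr a' * r by rewrite ltr_pM2r.
rewrite mulrBl divfK ?gt_eqF// => ?.
by have : g = a * r - b - M by []; lra.
Qed.

Lemma convex_lsc_rat_minorant j r M :
  convex_ereal j -> lower_semicontinuous j -> (forall x, (0 <= j x)%E) ->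
  j 0 = 0%E -> 0 <= M -> (M%:E < j r)%E ->
  exists a b : rat, [/\ 0 < ratr b :> R,
    forall x, ((ratr a * x - ratr b)%:E <= j x)%E & M < ratr a * r - ratr b].
Proof.
move=> cj lj j0 j00 M0; have [r0|r0|<-] := ltgtP 0 r.
- exact: convex_lsc_rat_minorant_gt0.
(* A negative [r] is handled by reflecting [j]; the case [r = 0] contradicts [j 0 = 0 <= M]. *)
- move=> Mj.
  have [| | | | | | |a [b [b0 abj Mab]]] :=
      @convex_lsc_rat_minorant_gt0 (j \o -%R) (- r) M => //=.
  + move=> x y t t0 t1 /=; rewrite opprD -!mulrN; exact: cj.
  + apply/lower_semicontinuousP => c.
    have /lower_semicontinuousP/(_ c) oj := lj.
    by have /continuousP/(_ _ oj) := @opp_continuous R.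
  + by rewrite oppr0.
  + by rewrite oppr_gt0.
  + by rewrite opprK.
  + exists (- a), b; split=> // [x|]; last by move: Mab; rewrite rmorphN mulrN mulNr.
    by have := abj (- x); rewrite /= opprK rmorphN mulrN mulNr.
- by rewrite j00 lte_fin ltNge M0.
Qed.

Lemma convex_lsc_minorants j :
  convex_ereal j -> lower_semicontinuous j -> (forall x, (0 <= j x)%E) ->
  j 0 = 0%E ->
  exists l : nat -> R * R, [/\ forall n, 0 < (l n).2,
    forall n x, (((l n).1 * x - (l n).2)%:E <= j x)%E &
    forall x M, 0 <= M -> (M%:E < j x)%E ->
      exists n, M < (l n).1 * x - (l n).2].
Proof.
move=> cj lj j0 j00.
pose ok (c : rat * rat) := 0 < ratr c.2 :> R /\
  forall x, ((ratr c.1 * x - ratr c.2)%:E <= j x)%E.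
(* An index that does not encode a rational minorant gets the line of constant value [-1], which
   lies below [j >= 0] and is negative at [0]. *)
exists (fun n => if unpickle n is Some c then
  if `[< ok c >] then (ratr c.1, ratr c.2) else (0, 1) else (0, 1)).
split.
- by move=> n; case: unpickle => //= c; case: ifPn => // /asboolP[].
- have j1 x : ((0 * x - 1)%:E <= j x)%E.
    by apply: (le_trans _ (j0 x)); rewrite lee_fin mul0r sub0r oppr_le0.
  by move=> n x; case: unpickle => //= c; case: ifPn => // /asboolP[].
- move=> x M M0 Mj.
  have [a [b [b0 abj Mab]]] := convex_lsc_rat_minorant cj lj j0 j00 M0 Mj.
  exists (pickle (a, b)); rewrite pickleK.
  by case: ifPn => // /asboolPn; rewrite /ok/=; tauto.
Qed.

End convex_minorants.

(** * Finite maxima of affine minorants and their subgradients *)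

Section maxlines.
Context {R : realType} (l : nat -> R * R) (l2 : forall n, 0 < (l n).2).
Implicit Types (n : nat) (x y : R).

Fixpoint maxlines n x : R :=
  if n is k.+1 then Num.max (maxlines k x) ((l k).1 * x - (l k).2) else 0.

(** The slope of an affine piece attaining the maximum at [x]. The strict comparison keeps the
    earlier piece in a tie, and the slope is [0] while no line is positive. *)
Fixpoint maxslope n x : R :=
  if n is k.+1 then
    if maxlines k x < (l k).1 * x - (l k).2 then (l k).1 else maxslope k x
  else 0.

Lemma maxlines_nondecreasing x : nondecreasing_seq (maxlines ^~ x).
Proof. by apply/nondecreasing_seqP => n /=; rewrite le_max lexx. Qed.

Lemma maxlines_ge0 n x : 0 <= maxlines n x.
Proof. exact: (maxlines_nondecreasing x (leq0n n)). Qed.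

Lemma maxlines_ge_line n x : (l n).1 * x - (l n).2 <= maxlines n.+1 x.
Proof. by rewrite /= le_max lexx orbT. Qed.

Lemma maxlines_subgradient n x y :
  maxlines n x + maxslope n x * (y - x) <= maxlines n y.
Proof.
elim: n x y => [x y|n IH x y] /=; first by rewrite mul0r addr0.
rewrite maxElt; case: ifPn => xl; rewrite le_max; last by rewrite IH.
by apply/orP; right; lra.
Qed.

Lemma maxlines0 n : maxlines n 0 = 0.
Proof.
elim: n => //= n ->; rewrite mulr0 sub0r; apply/max_idPl.
by rewrite oppr_le0 ltW.
Qed.

Lemma maxslope_monotone n x y : 0 <= (maxslope n x - maxslope n y) * (x - y).
Proof.
have := maxlines_subgradient n x y; have := maxlines_subgradient n y x; lra.
Qed.

Lemma maxslope_bounded n : exists2 C, 0 < C &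
  forall x, `|maxslope n x| <= C.
Proof.
elim: n => [|n [C C0 IH]] /=; first by exists 1 => // x; rewrite normr0.
exists (Num.max C `|(l n).1|); first by rewrite lt_max C0.
by move=> x; case: ifPn => _; rewrite le_max ?lexx ?orbT// IH.
Qed.

(** Each line is negative at [0], so near [0] none of them exceeds the initial value [0] of the
    maximum. *)
Lemma maxslope_eq0 n : exists2 e, 0 < e &
  forall x, `|x| <= e -> maxslope n x = 0.
Proof.
elim: n => [|n [e e0 IH]] /=; first by exists 1.
(* For [|x| <= e'] the linear part is at most [(l n).2]; the [+ 1] allows a zero slope. *)
pose e' := (l n).2 / (`|(l n).1| + 1).
have e'0 : 0 < e' by rewrite divr_gt0// ltr_wpDl.
exists (Num.min e e'); first by rewrite lt_min e0.
move=> x; rewrite le_min => /andP[xe xe']; rewrite ltNge.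
suff -> : (l n).1 * x - (l n).2 <= maxlines n x by rewrite IH.
apply: le_trans (maxlines_ge0 n x); rewrite subr_le0.
rewrite (le_trans (ler_norm _))// normrM.
move: xe'; rewrite ler_pdivlMr ?ltr_wpDl// mulrC; apply: le_trans.
by rewrite ler_wpM2r// lerDl.
Qed.

Lemma maxslope_linear_bound n : exists2 C, 0 < C &
  forall x, `|maxslope n x| <= C * `|x|.
Proof.
have [C C0 HC] := maxslope_bounded n; have [e e0 He] := maxslope_eq0 n.
exists (C / e); first by rewrite divr_gt0.
move=> x; have [xe|ex] := leP `|x| e.
  by rewrite He// normr0 mulr_ge0// ltW// divr_gt0.
by rewrite (le_trans (HC x))// mulrAC ler_pdivlMr// ler_pM2l// ltW.
Qed.

(** The subgradient inequality from [x] to [0] bounds the maximum by [maxslope n x * x], and the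
    slope grows at most linearly. Hence [maxlines n] of an [L2] function is integrable. *)
Lemma maxlines_quadratic_bound n : exists2 C, 0 < C &
  forall x, maxlines n x <= C * `|x| ^+ 2.
Proof.
have [C C0 HC] := maxslope_linear_bound n; exists C => // x.
have := maxlines_subgradient n x 0.
rewrite maxlines0 sub0r mulrN subr_le0 => /le_trans; apply.
rewrite (le_trans (ler_norm _))// normrM expr2 mulrA.
by rewrite ler_wpM2r.
Qed.

Lemma measurable_maxlines n : measurable_fun [set: R] (maxlines n).
Proof.
elim: n => [|n IH] /=; first exact: measurable_cst.
by apply: measurable_maxr => //; apply: measurable_funB.
Qed.

Lemma measurable_maxslope n : measurable_fun [set: R] (maxslope n).
Proof.
elim: n => [|n IH] /=; first exact: measurable_cst.
apply: measurable_fun_ifT => //.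
apply: measurable_fun_ltr; first exact: measurable_maxlines.
by apply: measurable_funB => //; exact: measurable_funM.
Qed.

Lemma maxlines_le (j : R -> \bar R) n x : (forall y, (0 <= j y)%E) ->
  (forall k y, (((l k).1 * y - (l k).2)%:E <= j y)%E) ->
  ((maxlines n x)%:E <= j x)%E.
Proof. by move=> j0 lj; elim: n => //= n IH; rewrite EFin_max ge_max IH lj. Qed.

Lemma cvg_maxlines (j : R -> \bar R) :
  (forall x, (0 <= j x)%E) ->
  (forall n x, (((l n).1 * x - (l n).2)%:E <= j x)%E) ->
  (forall x M, 0 <= M -> (M%:E < j x)%E ->
      exists n, M < (l n).1 * x - (l n).2) ->
  forall x, (maxlines n x)%:E @[n --> \oo] --> j x.
Proof.
move=> j0 lj jl x.
have -> : j x = ereal_sup (range (fun n => (maxlines n x)%:E)).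
  apply/eqP; rewrite eq_le; apply/andP; split; last first.
    by apply: ge_ereal_sup => _ [n _ <-]; exact: maxlines_le.
  rewrite leNgt; apply/negP.
  set s := ereal_sup _ => sj.
  have ubs n : ((maxlines n x)%:E <= s)%E by apply: ereal_sup_ubound; exists n.
  have s0 : (0 <= s)%E := ubs 0%N.
  have sfin : s \is a fin_num by rewrite ge0_fin_numE// (lt_le_trans sj)// leey.
  (* If the supremum [s] were below [j x], some line of the family would exceed [s] at [x], yet that
     line enters the next maximum. *)
  have [|n] := jl x (fine s) (fine_ge0 s0); first by rewrite fineK.
  apply/negP; rewrite -leNgt -lee_fin fineK//.
  by apply: le_trans (ubs n.+1); rewrite lee_fin maxlines_ge_line.
apply: ereal_nondecreasing_cvgn => m n mn.
by rewrite lee_fin maxlines_nondecreasing.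
Qed.

End maxlines.

(** * The measure [nu (x) m_x] and its Tonelli and Fubini formulas *)

Section semidirect_product_measure.
Context (d d' : measure_display) (X : measurableType d) (Y : measurableType d')
  (R : realType) (nu : {measure set X -> \bar R}) (m : R.-fker X ~> Y).
Local Open Scope ereal_scope.

Definition semiprod (A : set (X * Y)) : \bar R :=
  \int[nu]_x m x (xsection A x).

Let measurable_sections A : measurable A ->
  measurable_fun setT (fun x => m x (xsection A x)).
Proof.
by move=> mA; apply: measurable_fun_xsection_finite_kernel; rewrite inE.
Qed.

Let semiprod0 : semiprod set0 = 0.
Proof. by apply: integral0_eq => x _; rewrite xsection0 measure0. Qed.

Let semiprod_ge0 A : 0 <= semiprod A. Proof. exact: integral_ge0. Qed.

Let semiprod_semi_sigma_additive : semi_sigma_additive semiprod.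
Proof.
move=> U mU tU mUU.
have -> : semiprod (\bigcup_n U n) =
    \int[nu]_x \sum_(n <oo) m x (xsection (U n) x).
  apply: eq_integral => x _; rewrite xsection_bigcup.
  apply/esym/cvg_lim => //; apply: measure_semi_sigma_additive.
  - by move=> n; exact: measurable_xsection.
  - exact: trivIset_xsection.
  - by apply: bigcup_measurable => n _; exact: measurable_xsection.
rewrite integral_nneseries//; last by move=> n; exact: measurable_sections.
by apply: is_cvg_nneseries => n _ _; exact: integral_ge0.
Qed.

HB.instance Definition _ := isMeasure.Build _ _ R semiprod
  semiprod0 semiprod_ge0 semiprod_semi_sigma_additive.

Import HBNNSimple.

(** The sign of [r] is constrained only for nonempty [A]: the level sets of a nonnegative simple
    function meet this condition for every real [r]. *)
Let integral_semiprod_indic (r : R) (A : set (X * Y)) : measurable A ->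
  (A !=set0 -> (0 <= r)%R) ->
  \int[semiprod]_z (r * \1_A z)%:E =
  \int[nu]_x \int[m x]_y (r * \1_A (x, y))%:E.
Proof.
move=> mA Ar.
have [/Ar r0|A0] := pselect (A !=set0); last first.
  move/set0P/negP/negPn/eqP : A0 => ->.
  transitivity (0 : \bar R).
    by apply: integral0_eq => z _; rewrite indic0 mulr0.
  apply/esym/integral0_eq => x _.
  by apply: integral0_eq => y _; rewrite indic0 mulr0.
have m1 (x : X) : measurable_fun setT (fun y => (\1_A (x, y))%:E : \bar R).
  exact/measurable_EFinP/measurableT_comp.
under [LHS]eq_integral do rewrite EFinM.
rewrite [LHS]ge0_integralZl//=; last exact/measurable_EFinP.
rewrite integral_indic// setIT.
under [RHS]eq_integral => x _.
  under eq_integral do rewrite EFinM.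
  rewrite ge0_integralZl//=.
  have -> : \int[m x]_y (\1_A (x, y))%:E = m x (xsection A x).
    rewrite -[xsection A x]setIT -integral_indic//; last first.
      exact: measurable_xsection.
    by apply: eq_integral => y _; rewrite !indicE /xsection /= mem_setE.
  over.
by rewrite ge0_integralZl//=; exact: measurable_sections.
Qed.

Let integral_semiprod_nnsfun (f : {nnsfun (X * Y) >-> R}) :
  \int[semiprod]_z (f z)%:E = \int[nu]_x \int[m x]_y (f (x, y))%:E.
Proof.
have fE z : (f z)%:E =
    \sum_(r \in range f) (r * \1_(f @^-1` [set r]) z)%:E.
  by rewrite fimfunE -fsumEFin.
have f_ge0 r : f @^-1` [set r] !=set0 -> (0 <= r)%R.
  by move=> [z /= <-].
have fr_ge0 r z : 0 <= (r * \1_(f @^-1` [set r]) z)%:E.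
  by rewrite EFinM nnfun_muleindic_ge0.
have mfr r : measurable_fun setT
    (fun z => (r * \1_(f @^-1` [set r]) z)%:E : \bar R).
  by apply/measurable_EFinP; exact: measurable_funM.
under [LHS]eq_integral do rewrite fE.
rewrite [LHS]ge0_integral_fsum//.
under [RHS]eq_integral => x _.
  under eq_integral do rewrite fE.
  rewrite /= ge0_integral_fsum//; last first.
    by move=> r; exact: (measurable_fun_pair2 x (mfr r)).
  over.
rewrite /= ge0_integral_fsum//; first last.
- by move=> r x _; apply: integral_ge0.
- move=> r; exact: (measurable_fun_integral_finite_kernel _ m (fr_ge0 r) (mfr r)).
by apply: eq_fsbigr => r _; apply: integral_semiprod_indic => //; exact: f_ge0.
Qed.

Lemma ge0_integral_semiprod (f : X * Y -> \bar R) :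
  measurable_fun setT f -> (forall z, 0 <= f z) ->
  \int[semiprod]_z f z = \int[nu]_x \int[m x]_y f (x, y).
Proof.
move=> mf f0; pose g := nnsfun_approx measurableT mf.
have gf z : (g n z)%:E @[n --> \oo] --> f z by exact: cvg_nnsfun_approx.
have ndg z a b : (a <= b)%N -> ((g a z)%:E <= (g b z)%:E).
  by move=> ab; rewrite lee_fin; exact/lefP/nd_nnsfun_approx.
have mg n : measurable_fun setT (fun z => (g n z)%:E).
  exact/measurable_EFinP.
have mg2 n x : measurable_fun setT (fun y => (g n (x, y))%:E).
  exact: (measurable_fun_pair2 x (mg n)).
have -> : \int[semiprod]_z f z = limn (fun n => \int[semiprod]_z (g n z)%:E).
  rewrite -monotone_convergence//; last 2 first.
  - by move=> n z _; rewrite lee_fin.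
  - by move=> z _ a b; exact: ndg.
  by apply: eq_integral => z _; apply/esym/cvg_lim => //; exact: gf.
under eq_fun do rewrite integral_semiprod_nnsfun.
rewrite -monotone_convergence//; first last.
- move=> x _ a b ab; apply: ge0_le_integral => //.
    by move=> y _; rewrite lee_fin.
  by move=> y _; exact: ndg.
- by move=> n x _; apply: integral_ge0 => y _; rewrite lee_fin.
- move=> n; apply: (measurable_fun_integral_finite_kernel _ m _ (mg n)) => z.
  by rewrite lee_fin.
apply: eq_integral => x _.
rewrite -monotone_convergence//; last 2 first.
- by move=> n y _; rewrite lee_fin.
- by move=> y _ a b; exact: ndg.
by apply: eq_integral => y _; apply/cvg_lim => //; exact: gf.
Qed.

Lemma measurable_integral_kernel (f : X * Y -> \bar R) :
  measurable_fun setT f -> measurable_fun setT (fun x => \int[m x]_y f (x, y)).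
Proof.
move=> mf.
have -> : (fun x => \int[m x]_y f (x, y)) = (fun x =>
    \int[m x]_y f^\+ (x, y) - \int[m x]_y f^\- (x, y)).
  apply/funext => x; rewrite [LHS]integralE.
  by congr (_ - _); apply: eq_integral => y _; rewrite ?funeposE ?funenegE.
apply: emeasurable_funB.
  apply: (measurable_fun_integral_finite_kernel _ m) => //.
  exact: measurable_funepos.
apply: (measurable_fun_integral_finite_kernel _ m) => //.
exact: measurable_funeneg.
Qed.

(** Tonelli is applied to the positive and negative parts. Their inner integrals are
    [nu]-integrable, so the difference can be taken under the outer integral. *)
Lemma integral_semiprod (f : X * Y -> \bar R) :
  semiprod.-integrable setT f ->
  \int[semiprod]_z f z = \int[nu]_x \int[m x]_y f (x, y).
Proof.
move=> fi; have mf := measurable_int _ fi.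
have mfp : measurable_fun setT f^\+ by exact: measurable_funepos.
have mfn : measurable_fun setT f^\- by exact: measurable_funeneg.
rewrite [LHS]integralE !ge0_integral_semiprod//.
have inner (g : X * Y -> \bar R) : measurable_fun setT g ->
    (forall z, 0 <= g z) -> semiprod.-integrable setT g ->
    nu.-integrable setT (fun x => \int[m x]_y g (x, y)).
  move=> mg g0 /integrableP[_ gi]; apply/integrableP; split.
    exact: (measurable_fun_integral_finite_kernel _ m g0 mg).
  under eq_integral => x _ do rewrite gee0_abs ?integral_ge0//.
  rewrite -ge0_integral_semiprod//.
  rewrite [ltLHS](_ : _ = \int[semiprod]_z `|g z|)//.
  by apply: eq_integral => z _; rewrite gee0_abs.
rewrite -integralB//=.
- apply: eq_integral => x _; rewrite [in RHS]integralE.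
  by congr (_ - _); apply: eq_integral => y _; rewrite ?funeposE ?funenegE.
- by apply: inner => //; exact: integrable_funepos.
- by apply: inner => //; exact: integrable_funeneg.
Qed.

End semidirect_product_measure.

(** * Integrable real functions and the space [L2] *)

Section integral_complements.
Context (d : measure_display) (T : measurableType d) (R : realType)
  (mu : {measure set T -> \bar R}).
Implicit Types f g u v : T -> R.

Lemma integral_EFin f : mu.-integrable setT (EFin \o f) ->
  (\int[mu]_x (f x)%:E)%E = (\int[mu]_x f x)%:E.
Proof. by move=> fi; rewrite /Rintegral fineK//; exact: integrable_fin_num. Qed.

Lemma le_integrable_EFin f g : measurable_fun setT f ->
  (forall x, `|f x| <= g x) -> mu.-integrable setT (EFin \o g) ->
  mu.-integrable setT (EFin \o f).
Proof.
move=> mf fg; apply: le_integrable => //; first exact/measurable_EFinP.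
by move=> x _ /=; rewrite lee_fin (le_trans (fg x))// ler_norm.
Qed.

Lemma integrable_EFinP f : measurable_fun setT f -> (forall x, 0 <= f x) ->
  mu.-integrable setT (EFin \o f) <-> (\int[mu]_x (f x)%:E < +oo)%E.
Proof.
move=> mf f0.
have fE : (\int[mu]_x `|(EFin \o f) x|)%E = (\int[mu]_x (f x)%:E)%E.
  by apply: eq_integral => x _; rewrite /= ger0_norm.
split=> [/integrableP[_]|fy]; first by rewrite fE.
by apply/integrableP; split; [exact/measurable_EFinP|rewrite fE].
Qed.

Lemma integrable_EFinD f g :
  mu.-integrable setT (EFin \o f) -> mu.-integrable setT (EFin \o g) ->
  mu.-integrable setT (EFin \o (fun x => f x + g x)).
Proof. by move=> fi gi; exact: integrableD fi gi. Qed.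

Lemma integrable_EFinZ (a : R) f : mu.-integrable setT (EFin \o f) ->
  mu.-integrable setT (EFin \o (fun x => a * f x)).
Proof. by move=> fi; exact: (integrableZl measurableT a fi). Qed.

Lemma integrable_EFinB f g :
  mu.-integrable setT (EFin \o f) -> mu.-integrable setT (EFin \o g) ->
  mu.-integrable setT (EFin \o (fun x => f x - g x)).
Proof. by move=> fi gi; exact: integrableB fi gi. Qed.

Lemma Rdominated_convergence (f_ : nat -> T -> R) f g :
  (forall n, measurable_fun setT (f_ n)) -> measurable_fun setT f ->
  (forall x, f_ n x @[n --> \oo] --> f x) ->
  mu.-integrable setT (EFin \o g) -> (forall n x, `|f_ n x| <= g x) ->
  \int[mu]_x f_ n x @[n --> \oo] --> \int[mu]_x f x.
Proof.
move=> mf_ mf f_f gi f_g.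
have [] := @dominated_convergence _ _ _ mu setT measurableT
  (fun n => EFin \o f_ n) (EFin \o f) (EFin \o g).
- by move=> n; exact/measurable_EFinP.
- exact/measurable_EFinP.
- by apply/aeW => x _ /=; apply: cvg_EFin; [exact: nearW|exact: f_f].
- exact: gi.
- by apply/aeW => x n _ /=; rewrite lee_fin.
move=> fi _ cvgf; apply: fine_cvg; rewrite fineK//.
exact: integrable_fin_num.
Qed.

Lemma L2_integrableM u v : L2 mu u -> L2 mu v ->
  mu.-integrable setT (EFin \o (fun x => u x * v x)).
Proof.
move=> [mu_ ui] [mv vi].
have msq (w : T -> R) : measurable_fun setT w -> measurable_fun setT (fun x => `|w x| ^+ 2).
  by move=> mw; apply: measurable_funX; exact: measurableT_comp.
apply: (@le_integrable_EFin _ (fun x => `|u x| ^+ 2 + `|v x| ^+ 2)).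
- exact: measurable_funM.
- move=> x; rewrite normrM.
  have := sqr_ge0 (`|u x| - `|v x|); have := sqr_ge0 (`|u x| + `|v x|); nra.
- by apply: integrable_EFinD; apply/integrable_EFinP => //; exact: msq.
Qed.

Lemma L2P u : measurable_fun setT u ->
  L2 mu u <-> mu.-integrable setT (EFin \o (fun x => `|u x| ^+ 2)).
Proof.
move=> mu_; rewrite integrable_EFinP//; first by split=> [[]|].
by apply: measurable_funX; exact: measurableT_comp.
Qed.

Lemma L2_lin (a : R) u v : L2 mu u -> L2 mu v -> L2 mu (fun x => u x + a * v x).
Proof.
move=> Lu Lv; have [mu_ _] := Lu; have [mv _] := Lv.
have m1 : measurable_fun setT (fun x => u x + a * v x).
  by apply: measurable_funD => //; exact: measurable_funM.
apply/L2P => //.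
apply: (@le_integrable_EFin _ (fun x => 2 * `|u x| ^+ 2 + 2 * a ^+ 2 * `|v x| ^+ 2)).
- by apply: measurable_funX; exact: measurableT_comp.
- move=> x; rewrite normrX normr_id !real_normK ?num_real//.
  have := sqr_ge0 (u x - a * v x); nra.
- by apply: integrable_EFinD; apply: integrable_EFinZ; exact/L2P.
Qed.

Lemma L2N v : L2 mu v -> L2 mu (fun x => - v x).
Proof.
move=> [mv vi]; split; first exact: measurableT_comp.
by under eq_integral do rewrite normrN.
Qed.

End integral_complements.

(** * Reversibility as symmetry of the measure on pairs *)

Section edge_measure.
Context (d : measure_display) (T : measurableType d) (R : realType)
  (nu : {measure set T -> \bar R}) (m : R.-pker T ~> T).

Definition edge_measure : {measure set (T * T) -> \bar R} := semiprod nu m.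

Lemma edge_measureX (A B : set T) : measurable A -> measurable B ->
  edge_measure (A `*` B) = (\int[nu]_(x in A) m x B)%E.
Proof.
move=> mA mB; rewrite [RHS]integral_mkcond; apply: eq_integral => x _.
rewrite patchE; case: ifPn => xA; first by rewrite in_xsectionX.
by rewrite notin_xsectionX// measure0.
Qed.

Lemma ge0_integral_edge (f : T * T -> \bar R) :
  measurable_fun setT f -> (forall z, (0 <= f z)%E) ->
  (\int[edge_measure]_z f z = \int[nu]_x \int[m x]_y f (x, y))%E.
Proof. exact: ge0_integral_semiprod. Qed.

Lemma integral_edge (f : T * T -> \bar R) :
  edge_measure.-integrable setT f ->
  (\int[edge_measure]_z f z = \int[nu]_x \int[m x]_y f (x, y))%E.
Proof. exact: integral_semiprod. Qed.

Hypotheses (hsf : sigma_finite setT nu) (hrev : rw_reversible nu m).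

Let measurable_swap_pair : measurable_fun setT (@swap_pair T T).
Proof. exact: measurable_swap. Qed.

(** Reversibility gives equality on rectangles, a family stable under intersection that generates
    the product sigma-algebra. Uniqueness of measures applies along squares [F n x F n] of finite
    measure. *)
Lemma edge_measure_swap (A : set (T * T)) : measurable A ->
  pushforward edge_measure (@swap_pair T T) A = edge_measure A.
Proof.
have /sigma_finiteP[F [FT ndF Foo]] := hsf.
pose C : set (set (T * T)) :=
  [set C | exists A, measurable A /\ exists B, measurable B /\ C = A `*` B].
have CI : setI_closed C.
  move=> _ _ [X1 [mX1 [X2 [mX2 ->]]]] [Y1 [mY1 [Y2 [mY2 ->]]]].
  rewrite -setXI; exists (X1 `&` Y1); split; first exact: measurableI.
  by exists (X2 `&` Y2); split => //; exact: measurableI.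
have swapX (B1 B2 : set T) : @swap_pair T T @^-1` (B1 `*` B2) = B2 `*` B1.
  by apply/seteqP; split => -[x y] [].
have PX B1 B2 : measurable B1 -> measurable B2 ->
    pushforward edge_measure (@swap_pair T T) (B1 `*` B2) = edge_measure (B1 `*` B2).
  move=> mB1 mB2.
  by rewrite /pushforward swapX !edge_measureX// hrev.
move=> mA; apply: (measure_unique C (fun n => F n `*` F n)) => //.
- rewrite measurable_prod_measurableType; congr (<<s _ >>).
  rewrite predeqE; split => [[B mB [D mD <-]]|[B [mB [D [mD ->]]]]].
    by exists B; split => //; exists D.
  by exists B => //; exists D.
- move=> n; exists (F n); split; first by have [] := Foo n.
  by exists (F n); split => //; have [] := Foo n.
(* The squares cover the product because the sets [F n] increase. *)
- rewrite predeqE => -[x y]; split => // _.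
  have [i _ Fix] : (\bigcup_n F n) x by rewrite -FT.
  have [k _ Fky] : (\bigcup_n F n) y by rewrite -FT.
  exists (maxn i k) => //; split => /=.
  + by move: Fix; exact/subsetPset/ndF/leq_maxl.
  + by move: Fky; exact/subsetPset/ndF/leq_maxr.
- by move=> _ [B1 [mB1 [B2 [mB2 ->]]]]; exact: PX.
- move=> n; have [mF Fy] := Foo n; rewrite /= PX// edge_measureX//.
  (* As [m x] has mass [1], the square has measure at most [nu (F n)]. *)
  apply: le_lt_trans Fy; rewrite -[leRHS]mul1e -integral_cst//.
  apply: ge0_le_integral => //.
  + by apply: measurable_funTS; exact: measurable_kernel.
  + by move=> x _; rewrite -(@prob_kernel _ _ _ _ _ m x) le_measure ?inE.
Qed.

Lemma integrable_edge_swap (f : T * T -> \bar R) :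
  edge_measure.-integrable setT f ->
  edge_measure.-integrable setT (f \o @swap_pair T T).
Proof.
move=> fi; have mf := measurable_int _ fi.
apply/integrableP; split; first exact: measurableT_comp measurable_swap_pair.
have := (@ge0_integral_pushforward _ _ _ _ R _ measurable_swap_pair
  edge_measure setT (abse \o f)) measurableT.
rewrite preimage_setT => <-; first last.
- by move=> z _ /=.
- exact: measurableT_comp.
rewrite (eq_measure_integral edge_measure); first by case/integrableP : fi.
by move=> A mA _; exact: edge_measure_swap.
Qed.

Lemma integral_edge_swap (f : T * T -> \bar R) :
  edge_measure.-integrable setT f ->
  (\int[edge_measure]_z f z = \int[edge_measure]_z f (z.2, z.1))%E.
Proof.
move=> fi; have mf := measurable_int _ fi.
have := @integral_pushforward _ _ _ _ R _ measurable_swap_pair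
  edge_measure setT f mf (integrable_edge_swap fi) measurableT.
rewrite preimage_setT => <-; apply/esym/eq_measure_integral => A mA _.
exact: edge_measure_swap.
Qed.

End edge_measure.

(** * Functions of finite energy *)

Section p_energy.
Context (d : measure_display) (T : measurableType d) (R : realType)
  (nu : {measure set T -> \bar R}) (m : R.-pker T ~> T).
Hypotheses (hsf : sigma_finite setT nu) (hrev : rw_reversible nu m).
Context (p : R) (p1 : 1 < p).
Implicit Types (u v w phi : T -> R) (z : T * T).

Local Notation P := (edge_measure nu m).

Definition edge_grad u z : R := grad u z.1 z.2.

Let p0 : 0 < p. Proof. exact: lt_trans p1. Qed.

Lemma measurable_edge_grad u : measurable_fun setT u ->
  measurable_fun setT (edge_grad u).
Proof.
move=> mu; apply: measurable_funB.
  exact: measurableT_comp mu measurable_snd.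
exact: measurableT_comp mu measurable_fst.
Qed.

Lemma measurable_powR_edge_grad u : measurable_fun setT u ->
  measurable_fun setT (fun z => `|edge_grad u z| `^ p).
Proof.
move=> mu; apply: (@measurableT_comp _ _ _ _ _ _ (fun x : R => x `^ p)) => //.
by apply: measurableT_comp => //; exact: measurable_edge_grad.
Qed.

Lemma measurable_spow_edge_grad u : measurable_fun setT u ->
  measurable_fun setT (fun z => spow p (edge_grad u z)).
Proof.
move=> mu; apply: measurableT_comp (measurable_spow p1) _.
exact: measurable_edge_grad.
Qed.

Lemma energyE u : measurable_fun setT u ->
  energy nu m p u = (\int[P]_z (`|edge_grad u z| `^ p)%:E)%E.
Proof.
move=> mu; rewrite ge0_integral_edge//.
by apply/measurable_EFinP; exact: measurable_powR_edge_grad.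
Qed.

Definition finite_energy u :=
  measurable_fun setT u /\ (energy nu m p u < +oo)%E.

Lemma finite_energyP u : finite_energy u <-> measurable_fun setT u /\
  P.-integrable setT (EFin \o (fun z => `|edge_grad u z| `^ p)).
Proof.
split=> [[mu ui]|[mu /integrable_EFinP ui]]; split => //.
  apply/integrable_EFinP; first exact: measurable_powR_edge_grad.
    by move=> z; rewrite powR_ge0.
  by rewrite -energyE.
rewrite energyE//; apply: ui; first exact: measurable_powR_edge_grad.
by move=> z; rewrite powR_ge0.
Qed.

Lemma finite_energy_lin (a : R) u v : finite_energy u -> finite_energy v ->
  finite_energy (fun x => u x + a * v x).
Proof.
move=> /finite_energyP[mu ui] /finite_energyP[mv vi]; apply/finite_energyP.
have mw : measurable_fun setT (fun x => u x + a * v x).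
  by apply: measurable_funD => //; exact: measurable_funM.
split => //; apply: (@le_integrable_EFin _ _ _ _ _ (fun z =>
  2 `^ p * (`|edge_grad u z| `^ p + `|a| `^ p * `|edge_grad v z| `^ p))).
- exact: measurable_powR_edge_grad.
- move=> z; rewrite ger0_norm ?powR_ge0// -powRM// -normrM.
  apply: le_trans (powR_normD_le _ _ (ltW p0)).
  suff -> : edge_grad (fun x => u x + a * v x) z =
      edge_grad u z + a * edge_grad v z by [].
  by rewrite /edge_grad /grad; ring.
- apply: integrable_EFinZ; apply: integrable_EFinD => //.
  exact: integrable_EFinZ.
Qed.

Lemma integrable_spow_grad u w : finite_energy u -> finite_energy w ->
  P.-integrable setT (EFin \o (fun z => spow p (edge_grad u z) * edge_grad w z)).
Proof.
move=> /finite_energyP[mu ui] /finite_energyP[mw wi].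
apply: (@le_integrable_EFin _ _ _ _ _ (fun z =>
  `|edge_grad u z| `^ p + `|edge_grad w z| `^ p)).
- apply: measurable_funM; first exact: measurable_spow_edge_grad.
  exact: measurable_edge_grad.
- by move=> z; exact: spow_young_le.
- exact: integrable_EFinD.
Qed.

(** * Test functions and integrability on pairs *)

Definition test_function phi := measurable_fun setT phi /\
  exists C : R, exists A, [/\ 0 <= C, measurable A, (nu A < +oo)%E &
    forall x, `|phi x| <= C * \1_A x].

Lemma integrable_indic_fst A : measurable A -> (nu A < +oo)%E ->
  P.-integrable setT (EFin \o (fun z => \1_A z.1)).
Proof.
move=> mA Ay.
have m1 : measurable_fun setT (fun z : T * T => \1_A z.1 : R).
  exact: measurableT_comp measurable_fst.
apply/integrable_EFinP => //.
rewrite ge0_integral_edge//=; last exact/measurable_EFinP.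
under eq_integral do rewrite integral_cst// prob_kernel mule1.
by rewrite integral_indic// setIT.
Qed.

Lemma integrable_indic_snd A : measurable A -> (nu A < +oo)%E ->
  P.-integrable setT (EFin \o (fun z => \1_A z.2)).
Proof.
by move=> mA Ay; exact: (integrable_edge_swap hsf hrev (integrable_indic_fst mA Ay)).
Qed.

(** [|grad phi|^p] is at most a constant times the sum of the indicators of [A] in the two
    variables. The second one is integrable by reversibility. *)
Lemma test_function_finite_energy phi : test_function phi -> finite_energy phi.
Proof.
move=> [mphi [C [A [C0 mA Ay phiC]]]]; apply/finite_energyP; split => //.
apply: (@le_integrable_EFin _ _ _ _ _ (fun z =>
  2 `^ p * (C `^ p * \1_A z.2 + C `^ p * \1_A z.1))).
- exact: measurable_powR_edge_grad.
- move=> z; rewrite ger0_norm ?powR_ge0//.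
  apply: (le_trans (powR_normD_le _ _ (ltW p0))).
  rewrite normrN ler_wpM2l ?powR_ge0//.
  have phi_p x : `|phi x| `^ p <= C `^ p * \1_A x.
    have := phiC x; rewrite indicE; case: (x \in A) => /=.
      by rewrite !mulr1 => phix; apply: ge0_ler_powR; rewrite ?nnegrE// ltW.
    by rewrite !mulr0 normr_le0 => /eqP ->; rewrite normr0 powR0// gt_eqF.
  exact: lerD.
- apply: integrable_EFinZ; apply: integrable_EFinD; apply: integrable_EFinZ.
    exact: integrable_indic_snd.
  exact: integrable_indic_fst.
Qed.

Lemma test_function_L2 phi : test_function phi -> L2 nu phi.
Proof.
move=> [mphi [C [A [C0 mA Ay phiC]]]]; apply/L2P => //.
apply: (@le_integrable_EFin _ _ _ _ _ (fun x => C ^+ 2 * \1_A x)).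
- by apply: measurable_funX; exact: measurableT_comp.
- move=> x; rewrite normrX normr_id; have := phiC x.
  rewrite indicE; case: (x \in A) => /=; last first.
    by rewrite !mulr0 normr_le0 => /eqP ->; rewrite normr0 expr0n.
  by rewrite !mulr1 => ?; rewrite lerXn2r ?nnegrE.
- apply: integrable_EFinZ; apply/integrable_EFinP => //.
  by rewrite integral_indic// setIT.
Qed.

Lemma test_functionZ (a : R) phi : test_function phi ->
  test_function (fun x => a * phi x).
Proof.
move=> [mphi [C [A [C0 mA Ay phiC]]]]; split; first exact: measurable_funM.
exists (`|a| * C), A; split => //; first exact: mulr_ge0.
by move=> x; rewrite normrM -mulrA ler_wpM2l.
Qed.

Lemma test_function_indic A : measurable A -> (nu A < +oo)%E ->
  test_function (\1_A).
Proof.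
move=> mA Ay; split; first exact: measurable_indic.
by exists 1, A; split => // x; rewrite mul1r ger0_norm.
Qed.

(** Chebyshev's inequality: the indicator of the level set is at most [|u|^2 / e^2]. *)
Lemma L2_level_finite u (e : R) : L2 nu u -> 0 < e ->
  measurable [set x | e <= `|u x|] /\ (nu [set x | (e <= `|u x|)%R] < +oo)%E.
Proof.
move=> Lu e0; have [mu _] := Lu; set A := [set x | _].
have mA : measurable A.
  rewrite -[A]setTI; apply: measurable_fun_le => //.
  exact: measurableT_comp.
split => //.
have : nu.-integrable setT (EFin \o (fun x => \1_A x : R)).
  apply: (@le_integrable_EFin _ _ _ _ _ (fun x => e ^- 2 * `|u x| ^+ 2)).
  - exact: measurable_indic.
  - move=> x; rewrite indicE; case: (boolP (x \in A)) => [|_] /=; last first.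
      by rewrite normr0 mulr_ge0// invr_ge0 exprn_ge0// ltW.
    rewrite inE /A/= => ex; rewrite normr1 mulrC ler_pdivlMr ?exprn_gt0// mul1r.
    by rewrite lerXn2r ?nnegrE// ltW.
  - by apply: integrable_EFinZ; exact/L2P.
move=> /integrable_EFinP; rewrite integral_indic// setIT; apply => //.
exact: measurable_indic.
Qed.

Lemma test_function_comp u (q : R -> R) (C e : R) :
  L2 nu u -> measurable_fun setT q -> 0 <= C -> 0 < e ->
  (forall r, `|q r| <= C) -> (forall r, `|r| <= e -> q r = 0) ->
  test_function (q \o u).
Proof.
move=> Lu mq C0 e0 qC qe; split; first by case: Lu => mu _; exact: measurableT_comp.
have [mA Ay] := L2_level_finite Lu e0.
exists C, [set x | e <= `|u x|]; split => // x /=; rewrite indicE.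
have [ue|ue] := leP `|u x| e; first by rewrite qe// normr0 mulr_ge0.
by rewrite mem_set/= ?mulr1//; exact: ltW.
Qed.

Lemma integrable_test_spow phi u : test_function phi -> finite_energy u ->
  P.-integrable setT (EFin \o (fun z => phi z.1 * spow p (edge_grad u z))).
Proof.
move=> [mphi [C [A [C0 mA Ay phiC]]]] /finite_energyP[mu ui].
apply: (@le_integrable_EFin _ _ _ _ _ (fun z =>
  C * \1_A z.1 + C * `|edge_grad u z| `^ p)).
- apply: measurable_funM; last exact: measurable_spow_edge_grad.
  exact: measurableT_comp mphi measurable_fst.
- move=> z; rewrite normrM normr_spow//.
  apply: (@le_trans _ _ (C * \1_A z.1 * (1 + `|edge_grad u z| `^ p))).
    by apply: ler_pM => //; exact: powR_le_1D.
  rewrite mulrDr mulr1 lerD2l ler_wpM2r ?powR_ge0//.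
  by rewrite indicE; case: (_ \in _); rewrite ?mulr1 ?mulr0.
- apply: integrable_EFinD; apply: integrable_EFinZ => //.
  exact: integrable_indic_fst.
Qed.

(** Finite energy makes the inner integral of [|grad u|^p] finite for almost every [x]. Constants
    are integrable for the probability [m x], so [powR_le_1D] applies. *)
Lemma ae_integrable_spow u : finite_energy u ->
  {ae nu, forall x, (m x).-integrable setT
    (EFin \o (fun y => spow p (grad u x y)))}.
Proof.
move=> [mu ui].
have mG : measurable_fun setT (fun z => (`|edge_grad u z| `^ p)%:E).
  by apply/measurable_EFinP; exact: measurable_powR_edge_grad.
have hi : nu.-integrable setT
    (fun x => \int[m x]_y (`|grad u x y| `^ p)%:E)%E.
  apply/integrableP; split; first exact: (measurable_integral_kernel m mG).
  under eq_integral => x _.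
    rewrite gee0_abs; last first.
      by apply: integral_ge0 => y _; rewrite lee_fin powR_ge0.
    over.
  exact: ui.
have := integrable_ae measurableT hi; apply: filterS => x /(_ Logic.I) xfin.
apply: (@le_integrable_EFin _ _ _ _ _ (fun y => 1 + `|grad u x y| `^ p)).
- exact: (measurable_fun_pair2 x (measurable_spow_edge_grad mu)).
- by move=> y; rewrite normr_spow//; exact: powR_le_1D.
- apply: integrable_EFinD.
    apply/integrable_EFinP => //.
    by rewrite integral_cst//= prob_kernel mule1 ltry.
  apply/integrable_EFinP.
  + exact: (measurable_fun_pair2 x (measurable_powR_edge_grad mu)).
  + by move=> y; rewrite powR_ge0.
  + by rewrite -ge0_fin_numE// integral_ge0// => y _; rewrite lee_fin powR_ge0.
Qed.

(** * The weak formulation of the p-Laplacian *)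

Lemma edge_gradZ (a : R) phi z :
  edge_grad (fun x => a * phi x) z = a * edge_grad phi z.
Proof. by rewrite /edge_grad /grad mulrBr. Qed.

Lemma edge_gradDZ (a : R) u phi z :
  edge_grad (fun x => u x + a * phi x) z = edge_grad u z + a * edge_grad phi z.
Proof. by rewrite /edge_grad /grad; ring. Qed.

(* Exchanging the two variables in the integral of
   [phi x * spow p (grad u x y)] changes its sign. *)
Lemma integral_test_spow phi u v :
  test_function phi -> finite_energy u -> measurable_fun setT v ->
  {ae nu, forall x, (\int[m x]_y (spow p (grad u x y))%:E = (v x)%:E)%E} ->
  (\int[nu]_x (phi x * v x)%:E)%E =
  (- (2^-1 * \int[P]_z (spow p (edge_grad u z) * edge_grad phi z)))%:E.
Proof.
move=> tphi fu mv vE; have [mu _] := fu; have [mphi _] := tphi.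
have I1 := integrable_test_spow tphi fu.
have swapE z : edge_grad u (z.2, z.1) = - edge_grad u z.
  by rewrite /edge_grad /grad opprB.
have I2 : P.-integrable setT
    (EFin \o (fun z => phi z.2 * spow p (edge_grad u z))).
  have I1s : P.-integrable setT (EFin \o
      (fun z => phi z.2 * spow p (edge_grad u (z.2, z.1)))).
    exact: (integrable_edge_swap hsf hrev I1).
  apply: eq_integrable (integrable_EFinZ (-1) I1s) => // z _ /=.
  by rewrite swapE spowN mulrN mulN1r opprK.
(* Fubini: for almost every [x] the inner integral is [v x], and [phi x] comes out of it because the
   integrand is [m x]-integrable. *)
have -> : (\int[nu]_x (phi x * v x)%:E)%E =
    (\int[P]_z (phi z.1 * spow p (edge_grad u z)))%:E.
  rewrite -integral_EFin// integral_edge//; apply: ae_eq_integral => //.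
  - by apply/measurable_EFinP; exact: measurable_funM.
  - exact: (measurable_integral_kernel m (measurable_int _ I1)).
  - move: vE (ae_integrable_spow fu); apply: filterS2 => x xE xi _ /=.
    under [RHS]eq_integral do rewrite EFinM.
    by rewrite integralZl// xE.
have I12 : \int[P]_z (phi z.1 * spow p (edge_grad u z)) =
    - \int[P]_z (phi z.2 * spow p (edge_grad u z)).
  rewrite -[RHS]mulN1r -RintegralZl// /Rintegral integral_edge_swap//.
  congr fine; apply: eq_integral => z _ /=; congr EFin.
  by rewrite swapE spowN mulrN mulN1r.
have -> : \int[P]_z (spow p (edge_grad u z) * edge_grad phi z) =
    \int[P]_z (phi z.2 * spow p (edge_grad u z)) -
    \int[P]_z (phi z.1 * spow p (edge_grad u z)).
  rewrite -RintegralB//; apply: eq_Rintegral => z _.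
  by rewrite [edge_grad phi z]/edge_grad /grad; ring.
by rewrite I12; congr EFin; lra.
Qed.

(** Both sides pass to the limit along [trunc n \o phi] by dominated convergence: the left one is
    dominated since truncation decreases absolute values, the right one since it also decreases
    gradients. *)
Lemma integral_L2_spow phi u v :
  L2 nu phi -> finite_energy phi -> finite_energy u -> L2 nu v ->
  {ae nu, forall x, (\int[m x]_y (spow p (grad u x y))%:E = (v x)%:E)%E} ->
  \int[nu]_x (phi x * v x) =
  - (2^-1 * \int[P]_z (spow p (edge_grad u z) * edge_grad phi z)).
Proof.
move=> Lphi fphi fu Lv vE.
have [mphi _] := Lphi; have [mu _] := fu; have [mv _] := Lv.
have mtphi n : measurable_fun setT (trunc n \o phi).
  by apply: measurableT_comp => //; exact: measurable_trunc.
have cvgL : \int[nu]_x (trunc n (phi x) * v x) @[n --> \oo] -->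
    \int[nu]_x (phi x * v x).
  apply: (@Rdominated_convergence _ _ _ _ _ _ (fun x => `|phi x * v x|)).
  - by move=> n; exact: measurable_funM (mtphi n) mv.
  - exact: measurable_funM.
  - by move=> x; apply: cvgMl; exact: cvg_trunc.
  - exact: (integrable_norm (L2_integrableM Lphi Lv)).
  - by move=> n x; rewrite !normrM ler_wpM2r// normr_trunc_le.
have cvgR : \int[P]_z (spow p (edge_grad u z) *
      edge_grad (trunc n \o phi) z) @[n --> \oo] -->
    \int[P]_z (spow p (edge_grad u z) * edge_grad phi z).
  apply: (@Rdominated_convergence _ _ _ _ _ _
    (fun z => `|spow p (edge_grad u z) * edge_grad phi z|)).
  - move=> n; apply: measurable_funM; first exact: measurable_spow_edge_grad.
    exact: measurable_edge_grad.
  - apply: measurable_funM; first exact: measurable_spow_edge_grad.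
    exact: measurable_edge_grad.
  - by move=> z; apply: cvgMr; apply: cvgB; exact: cvg_trunc.
  - exact: (integrable_norm (integrable_spow_grad fu fphi)).
  - by move=> n z; rewrite !normrM ler_wpM2l// trunc_contraction.
have E n : \int[nu]_x (trunc n (phi x) * v x) = - (2^-1 *
    \int[P]_z (spow p (edge_grad u z) * edge_grad (trunc n \o phi) z)).
  have tn : test_function (trunc n \o phi).
    apply: (@test_function_comp _ _ n.+1%:R n.+1%:R^-1) => //.
    - exact: measurable_trunc.
    - by move=> r; exact: normr_trunc_le_cst.
    - by move=> r; exact: trunc_eq0.
  by rewrite /Rintegral (integral_test_spow tn fu mv vE).
rewrite (funext E) in cvgL; apply: (cvg_unique (@Rhausdorff R) cvgL).
by apply: cvgN; apply: cvgMr.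
Qed.

(** * The p-Laplacian and the subdifferential of the energy *)

Lemma FpmE u : L2 nu u -> finite_energy u ->
  Fpm nu m p u = ((2 * p)^-1 * \int[P]_z (`|edge_grad u z| `^ p))%:E.
Proof.
move=> Lu fu; have [mu ui] := fu; rewrite /Fpm.
case: pselect => [?|H] /=; last by case: H.
rewrite energyE// integral_EFin ?EFinM//.
by case/finite_energyP : fu.
Qed.

Lemma Delta_p_subdiff u v : Delta_p nu m p u v ->
  subdiff_L2 nu (Fpm nu m p) u (fun x => - v x).
Proof.
move=> [Lu Lv ui vE]; have [mu _] := Lu; have fu : finite_energy u by split.
split => //; [exact: L2N|by rewrite FpmE// ltry|move=> w Lw].
have [mw _] := Lw; have [wi|wy] := pselect (energy nu m p w < +oo)%E; last first.
  have -> : Fpm nu m p w = +oo%E.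
    by rewrite /Fpm; case: pselect => [H|?] /=; first by case: H.
  rewrite (FpmE Lu fu) -EFinN; exact: leey.
have fw : finite_energy w by split.
have Lphi : L2 nu (fun x => w x + -1 * u x) by exact: L2_lin.
have fphi : finite_energy (fun x => w x + -1 * u x) by exact: finite_energy_lin.
have vphi := L2_integrableM (L2N Lv) Lphi.
rewrite (FpmE Lw fw) (FpmE Lu fu) -EFinB.
under eq_integral do rewrite -[u _]mul1r -[- (1 * _)]mulNr.
rewrite integral_EFin// lee_fin.
have -> : \int[nu]_x (- v x * (w x + -1 * u x)) =
    - \int[nu]_x ((w x + -1 * u x) * v x).
  rewrite -[RHS]mulN1r -RintegralZl//; last exact: L2_integrableM.
  by apply: eq_Rintegral => x _; ring.
rewrite (integral_L2_spow Lphi fphi fu Lv vE) opprK -mulrBr.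
have /finite_energyP[_ Gu] := fu; have /finite_energyP[_ Gw] := fw.
(* The factor [1/2] of the weak formulation cancels against [1/(2p)], leaving the pointwise
   inequality [spow_subgradient]. *)
rewrite invfM -mulrA ler_pM2l ?invr_gt0// -RintegralB// -RintegralZl//; last first.
  exact: integrable_EFinB.
apply: le_Rintegral => //; first exact: integrable_spow_grad.
- by apply: integrable_EFinZ; exact: integrable_EFinB.
- by move=> z _; rewrite edge_gradDZ mulN1r; exact: spow_subgradient.
Qed.

(** The energy difference between [w n = u + t n * phi] and [u] is bounded above by the tangent
    inequality taken at [w n]. After division by [t n] only a limit of [spow p (edge_grad (w n) z)]
    remains. *)
Lemma subdiff_test u v phi : subdiff_L2 nu (Fpm nu m p) u (fun x => - v x) ->
  finite_energy u -> L2 nu v -> test_function phi ->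
  - (\int[nu]_x (phi x * v x)) <=
  2^-1 * \int[P]_z (spow p (edge_grad u z) * edge_grad phi z).
Proof.
move=> [Lu _ _ sub] fu Lv tphi; have [mu _] := Lu; have [mphi _] := tphi.
have Lphi := test_function_L2 tphi; have fphi := test_function_finite_energy tphi.
pose t (n : nat) : R := n.+1%:R^-1.
have t0 n : 0 < t n by rewrite invr_gt0 ltr0n.
have t1 n : t n <= 1 by rewrite invf_le1 ?ler1n ?ltr0n.
pose w n x := u x + t n * phi x.
have Lw n : L2 nu (w n) by exact: L2_lin.
have fw n : finite_energy (w n) by exact: finite_energy_lin.
have step n : - (\int[nu]_x (phi x * v x)) <=
    2^-1 * \int[P]_z (spow p (edge_grad (w n) z) * edge_grad phi z).
  have := sub _ (Lw n); rewrite (FpmE (Lw n) (fw n)) (FpmE Lu fu) -EFinB.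
  have -> : (\int[nu]_x (- v x * (w n x - u x))%:E)%E =
      (t n * - \int[nu]_x (phi x * v x))%:E.
    rewrite mulrN -mulNr -RintegralZl//; last exact: L2_integrableM.
    rewrite -integral_EFin; last by apply: integrable_EFinZ; exact: L2_integrableM.
    by apply: eq_integral => x _; congr EFin; rewrite /w; ring.
  rewrite lee_fin -mulrBr => le1; rewrite -(ler_pM2l (t0 n)).
  apply: (le_trans le1); rewrite mulrCA invfM -mulrA ler_pM2l ?invr_gt0//.
  have /finite_energyP[_ Gu] := fu; have /finite_energyP[_ Gw] := fw n.
  have Iw := integrable_spow_grad (fw n) fphi.
  rewrite -RintegralB// -!RintegralZl//; last exact: integrable_EFinB.
  apply: le_Rintegral => //.
  - by apply: integrable_EFinZ; exact: integrable_EFinB.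
  - exact: integrable_EFinZ.
  move=> z _.
  have := spow_subgradient (edge_grad (w n) z) (edge_grad u z) p1.
  by rewrite {2}edge_gradDZ; lra.
have fu1 : finite_energy (fun x => u x + 1 * phi x) by exact: finite_energy_lin.
have cvgR : 2^-1 * \int[P]_z (spow p (edge_grad (w n) z) * edge_grad phi z)
    @[n --> \oo] -->
    2^-1 * \int[P]_z (spow p (edge_grad u z) * edge_grad phi z).
  (* The majorant is the sum of the endpoint values given by [spow_segment_le], for [u] and
     [u + phi]. *)
  apply: cvgMr; apply: (@Rdominated_convergence _ _ _ _ _ _ (fun z =>
    `|spow p (edge_grad u z) * edge_grad phi z| +
    `|spow p (edge_grad (fun x => u x + 1 * phi x) z) * edge_grad phi z|)).
  - move=> n; apply: measurable_funM; last exact: measurable_edge_grad.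
    by apply: measurable_spow_edge_grad; case: (fw n).
  - apply: measurable_funM; last exact: measurable_edge_grad.
    exact: measurable_spow_edge_grad.
  - move=> z; apply: cvgMl.
    apply: (@cvg_comp _ _ _ (fun n => edge_grad (w n) z) (spow p) _
      (nbhs (edge_grad u z))); last exact: spow_continuous.
    under eq_fun do rewrite edge_gradDZ.
    have : edge_grad u z + t n * edge_grad phi z @[n --> \oo] -->
        edge_grad u z + 0 * edge_grad phi z.
      by apply: cvgD; [exact: cvg_cst|apply: cvgMl; exact: cvg_harmonic].
    by rewrite mul0r addr0; exact.
  - apply: integrable_EFinD.
      exact: (integrable_norm (integrable_spow_grad fu fphi)).
    exact: (integrable_norm (integrable_spow_grad fu1 fphi)).
  - move=> n z; rewrite !edge_gradDZ mul1r; apply: spow_segment_le => //.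
    by rewrite t1 ltW.
rewrite -(cvg_lim (@Rhausdorff R) cvgR); apply: limr_ge; last exact: nearW.
by apply/cvg_ex; eexists; exact: cvgR.
Qed.

Lemma subdiff_Delta_p u v : L2 nu u -> L2 nu v ->
  subdiff_L2 nu (Fpm nu m p) u (fun x => - v x) -> Delta_p nu m p u v.
Proof.
move=> Lu Lv sub; have [mu _] := Lu; have [mv _] := Lv.
have fu : finite_energy u.
  split => //; case: sub => _ _ + _; rewrite /Fpm.
  by case: pselect => [H|?] /=; [case: H|rewrite ltxx].
have [_ ui] := fu; split => //.
(* [V] is the actual p-Laplacian of [u], almost everywhere a finite integral; it remains to identify
   it with [v]. *)
pose V x := fine (\int[m x]_y (spow p (grad u x y))%:E)%E.
have mspow := measurable_spow_edge_grad mu.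
have mV : measurable_fun setT V.
  apply: (measurableT_comp (fine_measurable measurableT)).
  apply: (@measurable_integral_kernel _ _ _ _ _ m
    (EFin \o (fun z => spow p (edge_grad u z)))).
  exact/measurable_EFinP.
have VE : {ae nu, forall x, (\int[m x]_y (spow p (grad u x y))%:E = (V x)%:E)%E}.
  have := ae_integrable_spow fu; apply: filterS => x xi.
  by rewrite fineK//; exact: integrable_fin_num.
have vV phi : test_function phi ->
    (\int[nu]_x (phi x * v x)%:E = \int[nu]_x (phi x * V x)%:E)%E.
  move=> tphi; rewrite (integral_test_spow tphi fu mV VE).
  have Lphi := test_function_L2 tphi.
  have fphi := test_function_finite_energy tphi.
  have vphi := L2_integrableM Lphi Lv.
  have le1 := subdiff_test sub fu Lv tphi.
  (* Testing with [- phi] reverses the inequality. *)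
  have := subdiff_test sub fu Lv (test_functionZ (-1) tphi).
  have -> : \int[nu]_x (-1 * phi x * v x) = - \int[nu]_x (phi x * v x).
    rewrite -[RHS]mulN1r -RintegralZl//.
    by apply: eq_Rintegral => x _; rewrite mulrA.
  have -> : \int[P]_z (spow p (edge_grad u z) *
        edge_grad (fun x => -1 * phi x) z) =
      - \int[P]_z (spow p (edge_grad u z) * edge_grad phi z).
    rewrite -[RHS]mulN1r -RintegralZl//; last exact: integrable_spow_grad.
    by apply: eq_Rintegral => z _; rewrite edge_gradZ; ring.
  by move=> le2; rewrite integral_EFin//; congr EFin; lra.
have integral_test_set (f : T -> R) E : measurable E ->
    (\int[nu]_(x in E) (f x)%:E = \int[nu]_x (\1_E x * f x)%:E)%E.
  move=> mE; rewrite integral_mkcond; apply: eq_integral => x _.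
  by rewrite patchE indicE; case: (x \in E); rewrite ?mul1r ?mul0r.
case: hsf => F FT Foo.
(* Indicators of measurable subsets of [F n] are test functions, so [v] and [V] have the same
   integral over each of them. *)
have aeF n : {ae nu, forall x, F n x -> (v x)%:E = (V x)%:E}.
  have [mF Fy] := Foo n.
  apply: (@integral_ae_eq _ _ _ nu (F n) mF (EFin \o V) (EFin \o v)).
  - apply/(integrable_mkcond _ mF).
    apply: eq_integrable (L2_integrableM (test_function_L2
      (test_function_indic mF Fy)) Lv) => // x _ /=.
    by rewrite patchE indicE; case: (x \in F n); rewrite ?mul1r ?mul0r.
  - by apply: measurable_funTS; exact/measurable_EFinP.
  move=> E EF mE; rewrite (integral_test_set v _ mE) (integral_test_set V _ mE).
  apply: vV.
  apply: test_function_indic => //; apply: le_lt_trans Fy.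
  by rewrite le_measure ?inE.
move: (ae_foralln aeF) VE; apply: filterS2 => x xF ->.
have [n _ Fnx] : (\bigcup_n F n) x by rewrite -FT.
by rewrite (xF n Fnx).
Qed.

(** * Complete accretivity *)

(** Subtracting the two weak formulations leaves half the integral of a product of two differences,
    one of [spow p] and one of [q]. Each has the sign of [grad u1 - grad u2] or vanishes. *)
Lemma neg_Delta_p_monotone u1 v1 u2 v2 (q : R -> R) :
  neg_op (Delta_p nu m p) u1 v1 -> neg_op (Delta_p nu m p) u2 v2 ->
  (forall r s, 0 <= (q r - q s) * (r - s)) ->
  test_function (fun x => q (u1 x - u2 x)) ->
  0 <= \int[nu]_x (q (u1 x - u2 x) * (v1 x - v2 x)).
Proof.
move=> [Lu1 Lv1 ui1 vE1] [Lu2 Lv2 ui2 vE2] q_nd tq.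
have fu1 : finite_energy u1 by split => //; case: Lu1.
have fu2 : finite_energy u2 by split => //; case: Lu2.
have Lq := test_function_L2 tq; have fq := test_function_finite_energy tq.
have [mv1 _] := Lv1; have [mv2 _] := Lv2.
have E1 := integral_test_spow tq fu1 mv1 vE1.
have E2 := integral_test_spow tq fu2 mv2 vE2.
rewrite integral_EFin in E1; last exact: L2_integrableM.
rewrite integral_EFin in E2; last exact: L2_integrableM.
case: E1 E2 => E1 [E2].
have -> : \int[nu]_x (q (u1 x - u2 x) * (v1 x - v2 x)) =
    \int[nu]_x (q (u1 x - u2 x) * - v2 x) -
    \int[nu]_x (q (u1 x - u2 x) * - v1 x).
  rewrite -RintegralB//; try exact: L2_integrableM.
  by apply: eq_Rintegral => x _; ring.
rewrite E1 E2 opprK addrC -mulrBr mulr_ge0 ?invr_ge0//.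
rewrite -RintegralB//; try exact: integrable_spow_grad.
apply: Rintegral_ge0 => z _; rewrite -mulrBl.
have := q_nd (u1 z.2 - u2 z.2) (u1 z.1 - u2 z.1).
have -> : u1 z.2 - u2 z.2 - (u1 z.1 - u2 z.1) =
    edge_grad u1 z - edge_grad u2 z by rewrite /edge_grad /grad; ring.
rewrite -[q _ - q _]/(edge_grad (fun x => q (u1 x - u2 x)) z).
move: (edge_grad (fun x => _) z) => g.
have := spow_monotone (edge_grad u1 z) (edge_grad u2 z) p1.
have [->|] := eqVneq (edge_grad u1 z) (edge_grad u2 z).
  by rewrite !subrr !mul0r.
rewrite -subr_eq0; move: (edge_grad u1 z - _) (spow p _ - _) => r s r0 sr gr.
(* Multiplying by [r ^+ 2 > 0] turns [s * g] into the product of the nonnegative numbers [s * r] and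
   [g * r]. *)
rewrite -(@pmulr_rge0 _ (r ^+ 2)) ?exprn_even_gt0//.
have -> : r ^+ 2 * (s * g) = (s * r) * (g * r) by ring.
exact: mulr_ge0.
Qed.

Lemma neg_Delta_p_completely_accretive :
  completely_accretive nu (neg_op (Delta_p nu m p)).
Proof.
move=> lam lam0 u1 v1 u2 v2 A1 A2 j cj lj j0 j00.
have [l [l2 lej supl]] := convex_lsc_minorants cj lj j0 j00.
have [Lu1 Lv1' _ _] := A1; have [Lu2 Lv2' _ _] := A2.
have unopp (v : T -> R) : (fun x => - - v x) = v.
  by apply/funext => x; rewrite opprK.
have Lv1 : L2 nu v1 by rewrite -[v1]unopp; exact: L2N.
have Lv2 : L2 nu v2 by rewrite -[v2]unopp; exact: L2N.
have L2B (u v : T -> R) : L2 nu u -> L2 nu v -> L2 nu (fun x => u x - v x).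
  move=> Lu Lv; rewrite (_ : (fun x => _) = (fun x => u x + -1 * v x)).
    exact: L2_lin.
  by apply/funext => x; rewrite mulN1r.
set w := fun x => u1 x - u2 x; set w' := fun x => w x + lam * (v1 x - v2 x).
have Lw : L2 nu w by exact: L2B.
have Lz : L2 nu (fun x => v1 x - v2 x) by exact: L2B.
have Lw' : L2 nu w' by exact: L2_lin.
have [mw _] := Lw; have [mw' _] := Lw'.
have mg n (u : T -> R) : measurable_fun setT u ->
    measurable_fun setT (fun x => maxlines l n (u x)).
  by move=> mu; exact: measurableT_comp (measurable_maxlines l n) mu.
have gi n u : L2 nu u ->
    nu.-integrable setT (EFin \o (fun x => maxlines l n (u x))).
  move=> Lu; have [mu _] := Lu.
  have [C C0 HC] := maxlines_quadratic_bound l2 n.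
  apply: (@le_integrable_EFin _ _ _ _ _ (fun x => C * `|u x| ^+ 2)).
  - exact: mg.
  - by move=> x; rewrite ger0_norm ?maxlines_ge0.
  - by apply: integrable_EFinZ; exact/L2P.
have le_n n : (\int[nu]_x (maxlines l n (w x))%:E <=
               \int[nu]_x (maxlines l n (w' x))%:E)%E.
  have tq : test_function (fun x => maxslope l n (w x)).
    have [C C0 HC] := maxslope_bounded l n.
    have [e e0 He] := maxslope_eq0 l2 n.
    apply: (@test_function_comp w (maxslope l n) C e) => //.
    - exact: measurable_maxslope.
    - exact: ltW.
  have qz := L2_integrableM (test_function_L2 tq) Lz.
  have := neg_Delta_p_monotone A1 A2 (maxslope_monotone l n) tq.
  rewrite !integral_EFin; [|exact: gi..]; rewrite lee_fin => qz0.
  (* The subgradient inequality at [w], with increment [w' - w = lam * (v1 - v2)], gives the upper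
     bound; monotonicity makes the integral of the added term nonnegative. *)
  apply: (@le_trans _ _ (\int[nu]_x (maxlines l n (w x) +
      lam * (maxslope l n (w x) * (v1 x - v2 x))))).
    rewrite RintegralD//; [|exact: gi|exact: integrable_EFinZ].
    by rewrite RintegralZl// lerDl mulr_ge0// ltW.
  apply: le_Rintegral => //; [|exact: gi|].
    by apply: integrable_EFinD; [exact: gi|exact: integrable_EFinZ].
  move=> x _; have := maxlines_subgradient l n (w x) (w' x).
  by rewrite /w' addrAC subrr add0r mulrCA.
have cvg_int : (\int[nu]_x (maxlines l n (w x))%:E @[n --> \oo] -->
    \int[nu]_x j (w x))%E.
  rewrite (_ : (\int[nu]_x j (w x))%E =
      (\int[nu]_x limn (fun n => (maxlines l n (w x))%:E))%E); last first.
    apply: eq_integral => x _; apply/esym/cvg_lim => //.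
    exact: (cvg_maxlines j0 lej supl).
  apply: (@cvg_monotone_convergence _ _ _ nu setT measurableT
    (fun n x => (maxlines l n (w x))%:E)).
  - by move=> n; apply/measurable_EFinP; exact: mg.
  - by move=> n x _; rewrite lee_fin maxlines_ge0.
  - by move=> x _ a b ab; rewrite lee_fin maxlines_nondecreasing.
(* Only the left side passes to the limit; on the right [maxlines l n <= j] suffices for every
   [n]. *)
rewrite -(cvg_lim (@ereal_hausdorff R) cvg_int); apply: lime_le.
  by apply/cvg_ex; eexists; exact: cvg_int.
apply: nearW => n; apply: (le_trans (le_n n)).
apply: ge0_le_integral => //.
- by move=> x _; rewrite lee_fin maxlines_ge0.
- by apply/measurable_EFinP; exact: mg.
- by apply: measurableT_comp => //; exact: lower_semicontinuous_measurable.
- by move=> x _; exact: maxlines_le.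
Qed.

End p_energy.

Theorem theorem2p11 (d : measure_display) (T : measurableType d) (R : realType)
  (m : R.-pker T ~> T) (nu : {measure set T -> \bar R})
  (hcg : countably_generated T) (hsf : sigma_finite setT nu)
  (hinv : rw_invariant nu m) (hrev : rw_reversible nu m)
  (p : R) (hp : 1 < p) :
  completely_accretive nu (neg_op (Delta_p nu m p)) /\
  (forall u v : T -> R, L2 nu u -> L2 nu v ->
     (Delta_p nu m p u v <-> subdiff_L2 nu (Fpm nu m p) u (fun x => - v x))).
Proof.
split; first exact: neg_Delta_p_completely_accretive.
move=> u v Lu Lv; split; first exact: Delta_p_subdiff.
exact: subdiff_Delta_p.
Qed.
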